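(* Let $p$ be an odd prime and $M\in SO(3)_p$. Then there exist $A\in G_x$, $\eta\in\mathbb{Q}_p\cup\{\infty\}$ and $C\in G_z$ with $M=A\,R_y(\eta)\,C$, and $M$ has exactly two distinct decompositions $M=A'B'C'$ with $(A',B',C')\in G_x\times G_y\times G_z$, namely $$(A',B',C')=(A,\,R_y(\eta),\,C)\quad\text{and}\quad (A',B',C')=\Big(\mathrm{diag}(1,-1,-1)\,A,\ R_y\!\left(\tfrac{1}{p\eta}\right),\ \mathrm{diag}(-1,-1,1)\,C\Big).$$
   Context: For $p$ odd, fix a unit $u\in\mathbb{Z}_p^\times$ that is not a square in $\mathbb{Q}_p$, and set $v=-u$ if $p\equiv 1 \pmod 4$, $v=-1$ if $p\equiv 3\pmod 4$. Let $A_+=\mathrm{diag}(1,-v,p)$ and $SO(3)_p=\{L\in M_{3\times 3}(\mathbb{Q}_p): L^\top A_+ L=A_+,\ \det L=1\}$. With canonical basis $\mathbf{e}_1,\mathbf{e}_2,\mathbf{e}_3$, $G_x$, $G_y$, $G_z$ denote the subgroups of $SO(3)_p$ fixing $\mathbf{e}_1$, $\mathbf{e}_2$, $\mathbf{e}_3$ respectively. For $\eta\in\mathbb{Q}_p$, $R_y(\eta)$ is the matrix with entries $(1,1)=(3,3)=\frac{1-p\eta^2}{1+p\eta^2}$, $(1,3)=-\frac{2p\eta}{1+p\eta^2}$, $(3,1)=\frac{2\eta}{1+p\eta^2}$, $(2,2)=1$ and all other entries $0$; $R_y(\infty)=\mathrm{diag}(-1,1,-1)$. Every element of $G_y$ equals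 $R_y(\eta)$ for a unique $\eta\in\mathbb{Q}_p\cup\{\infty\}$. Conventions: $\frac{1}{p\cdot 0}=\infty$, $\frac{1}{p\cdot\infty}=0$. *)

(* Defs.v *)
From HB Require Import structures.
From mathcomp Require Import all_boot all_order all_algebra.
From mathcomp Require Import boolp.

Set Implicit Arguments.
Unset Strict Implicit.
Unset Printing Implicit Defensive.

Import GRing.Theory.
Local Open Scope ring_scope.

(* The ring Z_p as the inverse limit of the rings Z/p^n: x n is the residue of
   x modulo p^n, represented in [0, p^n). The proof that p is prime is a
   parameter of the type, so that the ring structure can depend on it. *)
Record padic_int (p : nat) (p_pr : prime p) := PadicInt {
  padic_res :> nat -> nat;
  padic_resP : forall n, padic_res n = (padic_res n.+1 %% p ^ n)%N }.

HB.instance Definition _ p (p_pr : prime p) := gen_eqMixin (padic_int p_pr).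
HB.instance Definition _ p (p_pr : prime p) := gen_choiceMixin (padic_int p_pr).

Section PadicInt.
Variables (p : nat) (p_pr : prime p).
Local Notation Zp := (padic_int p_pr).
Implicit Types x y z : Zp.

Lemma padic_int_ext x y : x =1 y -> x = y.
Proof.
case: x y => [f Hf] [g Hg] /= /funext efg; case: _ / efg Hg => Hg.
by rewrite (Prop_irrelevance Hf Hg).
Qed.

Lemma padic_res_mod x n : (x n %% p ^ n)%N = x n.
Proof. by rewrite padic_resP modn_mod. Qed.

Lemma padic_res_modS x n : x n.+1 = x n %[mod p ^ n].
Proof. by rewrite -padic_resP padic_res_mod. Qed.

Fact padic_of_subproof (f : nat -> nat)
    (Hf : forall n, f n.+1 = f n %[mod p ^ n]) (n : nat) :
  (f n %% p ^ n = (f n.+1 %% p ^ n.+1) %% p ^ n)%N.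
Proof. by rewrite modn_dvdm ?Hf // dvdn_exp2l. Qed.

Definition padic_of (f : nat -> nat) (Hf : forall n, f n.+1 = f n %[mod p ^ n])
  : Zp := PadicInt p_pr (padic_of_subproof Hf).

Fact padic_cst_subproof (k n : nat) : k = k %[mod p ^ n].
Proof. by []. Qed.

Fact padic_add_subproof x y n : (x n.+1 + y n.+1 = x n + y n %[mod p ^ n])%N.
Proof. by rewrite -modnDm !padic_res_modS modnDm. Qed.

Fact padic_mul_subproof x y n : (x n.+1 * y n.+1 = x n * y n %[mod p ^ n])%N.
Proof. by rewrite -modnMm !padic_res_modS modnMm. Qed.

Lemma padic_res_le x n : (x n <= p ^ n)%N.
Proof. by rewrite -padic_res_mod ltnW // ltn_mod expn_gt0 prime_gt0. Qed.

Fact padic_opp_subproof x n :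
  (p ^ n.+1 - x n.+1 = p ^ n - x n %[mod p ^ n])%N.
Proof.
apply/eqP; rewrite -(eqn_modDr (x n.+1)) subnK ?padic_res_le //.
rewrite -[X in _ == X]modnDmr padic_res_modS modnDmr subnK ?padic_res_le //.
by rewrite expnS modnMl modnn.
Qed.

Definition padic_zero : Zp := padic_of (padic_cst_subproof 0).
Definition padic_one : Zp := padic_of (padic_cst_subproof 1).
Definition padic_add x y : Zp := padic_of (padic_add_subproof x y).
Definition padic_opp x : Zp := padic_of (padic_opp_subproof x).
Definition padic_mul x y : Zp := padic_of (padic_mul_subproof x y).

Fact padic_addA : associative padic_add.
Proof.
by move=> x y z; apply: padic_int_ext => n /=; rewrite modnDmr modnDml addnA.
Qed.

Fact padic_addC : commutative padic_add.
Proof. by move=> x y; apply: padic_int_ext => n /=; rewrite addnC. Qed.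

Fact padic_add0 : left_id padic_zero padic_add.
Proof.
by move=> x; apply: padic_int_ext => n /=; rewrite mod0n add0n padic_res_mod.
Qed.

Fact padic_addN : left_inverse padic_zero padic_opp padic_add.
Proof.
move=> x; apply: padic_int_ext => n /=.
by rewrite modnDml subnK ?padic_res_le // modnn mod0n.
Qed.

HB.instance Definition _ :=
  GRing.isZmodule.Build Zp padic_addA padic_addC padic_add0 padic_addN.

Fact padic_mulA : associative padic_mul.
Proof.
by move=> x y z; apply: padic_int_ext => n /=; rewrite modnMmr modnMml mulnA.
Qed.

Fact padic_mulC : commutative padic_mul.
Proof. by move=> x y; apply: padic_int_ext => n /=; rewrite mulnC. Qed.

Fact padic_mul1 : left_id padic_one padic_mul.
Proof.
by move=> x; apply: padic_int_ext => n /=; rewrite modnMml mul1n padic_res_mod.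
Qed.

Fact padic_mulDl : left_distributive padic_mul padic_add.
Proof.
move=> x y z; apply: padic_int_ext => n /=.
by rewrite modnMml modnDm mulnDl.
Qed.

Fact padic_one_neq0 : padic_one != 0.
Proof.
apply/eqP => /(congr1 (fun x : Zp => x 1%N)) /=.
by rewrite expn1 mod0n modn_small ?prime_gt1.
Qed.

HB.instance Definition _ := GRing.Zmodule_isComNzRing.Build Zp
  padic_mulA padic_mulC padic_mul1 padic_mulDl padic_one_neq0.

Definition padic_unit : {pred Zp} := fun x => `[< exists y, y * x = 1 >].

(* As required by the unit ring structure, the inverse is extended by the
   identity to the non-units. *)
Definition padic_inv x : Zp :=
  if pselect (exists y, y * x = 1) is left ex_inv then sval (cid ex_inv) else x.

Fact padic_mulV : {in padic_unit, left_inverse 1 padic_inv *%R}.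
Proof.
move=> x /asboolP ux; rewrite /padic_inv; case: pselect => [ex_inv|//].
by case: cid.
Qed.

Fact padic_unitPl x y : y * x = 1 -> padic_unit x.
Proof. by move=> yx1; apply/asboolP; exists y. Qed.

Fact padic_inv_out : {in [predC padic_unit], padic_inv =1 id}.
Proof.
move=> x /asboolP nux; rewrite /padic_inv.
by case: pselect => [ex_inv|//]; case: nux.
Qed.

HB.instance Definition _ := GRing.ComNzRing_hasMulInverse.Build Zp
  padic_mulV padic_unitPl padic_inv_out.

Lemma padic_res_modD x n m : x (n + m)%N = x n %[mod p ^ n].
Proof.
elim: m => [|m IHm]; first by rewrite addn0.
rewrite -IHm addnS.
have dvd_pn : (p ^ n %| p ^ (n + m))%N by rewrite dvdn_exp2l ?leq_addr.
by rewrite -(modn_dvdm _ dvd_pn) padic_res_modS modn_dvdm.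
Qed.

Fact padic_integral : GRing.integral_domain_axiom Zp.
Proof.
move=> x y xy0; apply/negPn/negP.
rewrite negb_or => /andP[/eqP x0 /eqP y0].
have nz (z : Zp) : z <> 0 -> exists n, z n != 0%N.
  move=> z0; apply: contrapT => nex; apply: z0; apply: padic_int_ext => n.
  rewrite /= mod0n; apply/eqP/negPn/negP => zn0; apply: nex; by exists n.
have [a xa0] := nz x x0; have [b yb0] := nz y y0.
have ndvd (z : Zp) n m : z n != 0%N -> ~~ (p ^ n %| z (n + m))%N.
  by move=> zn0; rewrite /dvdn padic_res_modD padic_res_mod.
have xa := ndvd x a b xa0.
have yb : ~~ (p ^ b %| y (a + b))%N by rewrite addnC; exact: ndvd.
have gt0 (c k : nat) : ~~ (p ^ c %| k)%N -> (0 < k)%N by case: k => //; rewrite dvdn0.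
have := congr1 (fun z : Zp => z (a + b)%N) xy0; rewrite /= mod0n => /eqP.
rewrite -/(dvdn _ _) pfactor_dvdn // ?muln_gt0 ?(gt0 _ _ xa) ?(gt0 _ _ yb) //.
move: (gt0 _ _ xa) (gt0 _ _ yb) => x_gt0 y_gt0.
move: xa yb; rewrite !pfactor_dvdn // -!ltnNge lognM // => lt_a lt_b.
by apply/negP; rewrite -ltnNge -addSn leq_add // ltnW.
Qed.

HB.instance Definition _ :=
  GRing.ComUnitRing_isIntegral.Build Zp padic_integral.

End PadicInt.

(* The field Q_p; the embedding of Z_p is the library's tofrac. *)
Definition padic (p : nat) (p_pr : prime p) : fieldType :=
  {fraction padic_int p_pr}.

Definition padic_of_int (p : nat) (p_pr : prime p) (x : padic_int p_pr) :
  padic p_pr := tofrac x.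

Definition diag3 (K : fieldType) (a b c : K) : 'M[K]_3 :=
  diag_mx (\row_(i < 3) [:: a; b; c]`_i).

Section SO3.
Variables (p : nat) (p_pr : prime p).
Local Notation Qp := (padic p_pr).

Definition v_of (u : padic_int p_pr) : Qp :=
  if (p == 1 %[mod 4])%N then - padic_of_int u else -1.

Variable u : padic_int p_pr.

Definition Aplus : 'M[Qp]_3 := diag3 1 (- v_of u) p%:R.

Definition SO3 : {pred 'M[Qp]_3} :=
  [pred L : 'M[Qp]_3 | (L^T *m Aplus *m L == Aplus) && (\det L == 1)].

(* Indexed from 0: basis_vec 0, 1, 2 are the vectors e_1, e_2, e_3. *)
Definition basis_vec (i : 'I_3) : 'cV[Qp]_3 := delta_mx i 0.

Definition SO3_fix (i : 'I_3) : {pred 'M[Qp]_3} :=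
  [pred L : 'M[Qp]_3 | (L \in SO3) && (L *m basis_vec i == basis_vec i)].

Definition Gx := SO3_fix 0.
Definition Gy := SO3_fix 1.
Definition Gz := SO3_fix 2.

End SO3.

Section Ry.
Variables (p : nat) (p_pr : prime p).
Local Notation Qp := (padic p_pr).

(* Q_p together with a point at infinity is [option Qp], infinity being None. *)
Definition Ry (eta : option Qp) : 'M[Qp]_3 :=
  if eta is Some t then
    let d := 1 + p%:R * t ^+ 2 in
    \matrix_(i < 3, j < 3) nth 0 (nth [::]
      [:: [:: (1 - p%:R * t ^+ 2) / d; 0; - (2%:R * p%:R * t / d)];
          [:: 0;                       1; 0];
          [:: 2%:R * t / d;            0; (1 - p%:R * t ^+ 2) / d]] i) j
  else diag3 (-1) 1 (-1).

(* eta |-> 1 / (p * eta) *)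
Definition inv_pmul (eta : option Qp) : option Qp :=
  if eta is Some t then
    if t == 0 then None else Some (p%:R * t)^-1
  else Some 0.

End Ry.

(* Main.v *)
(** Comparing first rows and third columns, the (1,3) entry of
    [A * R_y(eta) * C] is that of [R_y(eta)], namely [- p s] where
    [R_y(eta) = [[c, 0, - p s], [0, 1, 0], [s, 0, c]]] and
    [c^2 + p s^2 = 1].  So [M] determines [s], and a decomposition requires
    [1 - p s^2] to be a square.  The first row of [M] gives
    [x^2 - v y^2 + p s^2 = 1]; as [x^2 - v y^2] is anisotropic modulo [p],
    descent makes [s] integral, so [1 - p s^2] is congruent to 1 modulo [p] and
    has two square roots, which are nonzero, by Hensel's lemma.  Each of them
    determines [A] through the third column of [M], and then [C].  The change of
    sign of [c] at fixed [s] is [eta |-> 1 / (p eta)]. *)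
Require Import Defs.
From mathcomp Require Import all_boot all_order all_algebra all_field.
From mathcomp Require Import boolp generic_quotient ring zify.

Set Implicit Arguments.
Unset Strict Implicit.
Unset Printing Implicit Defensive.

Import GRing.Theory.
Local Open Scope ring_scope.

(** * Reduction modulo [p], Hensel lifting and descent in the p-adic integers *)

Section PadicResidue.
Variables (p : nat) (p_pr : prime p).
Local Notation Zp := (padic_int p_pr).
Implicit Types x y w : Zp.

Lemma padic_resM x y n : (x * y) n = (x n * y n %% p ^ n)%N.
Proof. by []. Qed.

Lemma padic_resD x y n : (x + y) n = ((x n + y n) %% p ^ n)%N.
Proof. by []. Qed.

Lemma padic_res0 n : (0 : Zp) n = 0%N.
Proof. exact: mod0n. Qed.

Lemma padic_res_nat k n : (k%:R : Zp) n = (k %% p ^ n)%N.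
Proof.
elim: k => [|k IHk]; first by rewrite padic_res0 mod0n.
rewrite -natr1 padic_resD IHk /= -[k.+1]addn1.
by rewrite modnDm.
Qed.

Lemma padic_res_pexp x n : (p%:R ^+ n * x) n = 0%N.
Proof. by rewrite -natrX padic_resM padic_res_nat modnn mul0n mod0n. Qed.

Lemma padic_res_pexpD x y n : (x + p%:R ^+ n * y) n = x n.
Proof. by rewrite padic_resD padic_res_pexp addn0 padic_res_mod. Qed.

(** Division by [p] costs one digit: the quotient at index [n] is read off from [x n.+1], which [p]
    divides. *)
Lemma padic_dvdp x : x 1%N = 0%N -> exists y, x = p%:R * y.
Proof.
move=> x1.
have p_gt0 := prime_gt0 p_pr.
have dvx n : (p %| x n.+1)%N.
  by have := padic_res_modD x 1 n; rewrite add1n x1 expn1 mod0n => /eqP.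
have yP n : (x n.+2 %/ p = x n.+1 %/ p %[mod p ^ n])%N.
  apply/eqP; rewrite -(eqn_pmul2r p_gt0) !muln_modl //.
  by rewrite !divnK // -!expnSr padic_res_modS.
exists (padic_of p_pr yP); apply: padic_int_ext => n.
rewrite padic_resM padic_res_nat modnMml /= modnMmr mulnC divnK //.
by rewrite padic_res_modS padic_res_mod.
Qed.

(** Index 1 carries the class modulo [p]; index 0 is always 0. *)
Definition residue x : 'F_p := (x 1%N)%:R.

Lemma residueD x y : residue (x + y) = residue x + residue y.
Proof. by rewrite /residue padic_resD expn1 Fp_nat_mod // natrD. Qed.

Lemma residueM x y : residue (x * y) = residue x * residue y.
Proof. by rewrite /residue padic_resM expn1 Fp_nat_mod // natrM. Qed.

Lemma residue_nat k : residue k%:R = k%:R.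
Proof. by rewrite /residue padic_res_nat expn1 Fp_nat_mod. Qed.

Lemma residueN x : residue (- x) = - residue x.
Proof.
by apply/eqP; rewrite -addr_eq0 -residueD addNr (residue_nat 0).
Qed.

Lemma residue_p : residue p%:R = 0.
Proof. by rewrite residue_nat pchar_Fp_0. Qed.

Lemma residue_eq0 x : residue x = 0 -> exists y, x = p%:R * y.
Proof.
move=> /(congr1 (@nat_of_ord _)); rewrite val_Fp_nat // -[X in (_ %% X)%N]expn1.
by rewrite padic_res_mod; exact: padic_dvdp.
Qed.

Lemma residue_surj (t : 'F_p) : exists x, residue x = t.
Proof. by exists (val t)%:R; rewrite residue_nat natr_Zp. Qed.

Lemma Fp_natr2_neq0 : odd p -> (2%:R : 'F_p) != 0.
Proof.
move=> p_odd; apply/eqP => /(congr1 (@nat_of_ord _)); rewrite val_Fp_nat //.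
by rewrite modn_small //; case: (p) p_odd (prime_gt1 p_pr) => [|[|[|k]]].
Qed.

Lemma padic_p_neq0 : (p%:R : Zp) != 0.
Proof.
apply/eqP => /(congr1 (fun x : Zp => x 2)); rewrite padic_res_nat padic_res0.
rewrite modn_small ?expnS ?expn0 ?muln1; last first.
  by rewrite -{1}[p]muln1 ltn_pmul2l ?prime_gt0 ?prime_gt1.
by move=> p0; have := prime_gt0 p_pr; rewrite p0.
Qed.

(* Hensel's lemma, with the inverse of the derivative frozen at the starting
   point: the iteration [r + (w - r^2) h] gains one power of [p] per step. *)
Lemma padic_hensel_sqr w (t : 'F_p) :
  odd p -> t != 0 -> residue w = t ^+ 2 -> exists r : Zp, r ^+ 2 = w.
Proof.
move=> p_odd t0 wt.
have [r0 r0t] := residue_surj t.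
have [h ht] := residue_surj (2%:R * t)^-1.
have [e0 we0] : exists y, w - r0 ^+ 2 = p%:R * y.
  apply: residue_eq0.
  by rewrite residueD residueN !expr2 residueM wt r0t expr2 subrr.
have [f0 rf0] : exists y, 1 - 2%:R * r0 * h = p%:R * y.
  apply: residue_eq0.
  rewrite residueD residueN !residueM ht r0t (residue_nat 1) residue_nat.
  by rewrite mulfV ?subrr // mulf_neq0 // Fp_natr2_neq0.
pose step (r : Zp) := r + (w - r ^+ 2) * h.
pose r n := iter n step r0.
(* Two invariants: [h] stays an inverse of [2 r n] modulo [p], and the error is divisible by
   [p ^ n.+1]. *)
have rP n : (exists f, 1 - 2%:R * r n * h = p%:R * f) /\
            (exists e, w - r n ^+ 2 = p%:R ^+ n.+1 * e).
  elim: n => [|n [[f rf] [e re]]]; first by split; [exists f0 | exists e0].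
  have rS : r n.+1 = r n + p%:R ^+ n.+1 * e * h by rewrite -re.
  split.
    exists (f - 2%:R * p%:R ^+ n * e * h ^+ 2).
    rewrite mulrBr -rf rS exprS; ring.
  exists (e * f - p%:R ^+ n * e ^+ 2 * h ^+ 2).
  have -> : w - r n.+1 ^+ 2 =
      (w - r n ^+ 2) - p%:R ^+ n.+1 * e * (2%:R * r n * h)
      - (p%:R ^+ n.+1 * e * h) ^+ 2 by rewrite rS; ring.
  have -> : 2%:R * r n * h = 1 - p%:R * f by rewrite -rf; ring.
  rewrite re !exprS; ring.
(* Successive iterates agree modulo [p ^ n.+1], so the diagonal [r n n] is a compatible sequence of
   residues. *)
have limP n : r n.+1 n.+1 = r n n %[mod p ^ n].
  rewrite padic_res_modS.
  have [_ [e re]] := rP n.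
  have -> : r n.+1 = r n + p%:R ^+ n * (p%:R * e * h).
    by rewrite [LHS]/= -/(r n) /step re exprS; ring.
  by rewrite padic_res_pexpD.
exists (padic_of p_pr limP); apply: padic_int_ext => n.
have [_ [e re]] := rP n.
have -> : w = r n ^+ 2 + p%:R ^+ n * (p%:R * e).
  by rewrite mulrA -exprSr -re; ring.
by rewrite padic_res_pexpD !expr2 !padic_resM /= !padic_res_mod.
Qed.

(** Infinite descent made finite: [D n != 0] bounds the valuation of [D]. If [p] does not divide
    [D], then [D ^+ 2 - p S ^+ 2] is a nonzero square modulo [p] and Hensel's lemma applies.
    Otherwise anisotropy makes [p] divide [X] and [Y], hence [S], and the equation is divided by
    [p ^ 2]. *)
Lemma padic_descent (a : Zp) (p_odd : odd p)
    (a_nonres : forall t : 'F_p, t ^+ 2 != - residue a) (n : nat) :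
  forall X Y S D : Zp, D n != 0%N ->
    X ^+ 2 + a * Y ^+ 2 + p%:R * S ^+ 2 = D ^+ 2 ->
  exists2 C : Zp, C != 0 & C ^+ 2 + p%:R * S ^+ 2 = D ^+ 2.
Proof.
elim: n => [|n IHn] X Y S D Dn eqD.
  (* Residues modulo [p ^ 0] vanish, so the hypothesis on [D] is absurd. *)
  by move: Dn; rewrite padic_resP modn1.
have resE := (residueD, residueM, expr2, residue_p, mul0r, addr0).
have [/residue_eq0 [D' DD'] | D0] := eqVneq (residue D) 0; last first.
  have DS : residue (D ^+ 2 - p%:R * S ^+ 2) = residue D ^+ 2.
    by rewrite !(residueN, resE) oppr0 addr0.
  have [C CE] := padic_hensel_sqr p_odd D0 DS.
  exists C; last by rewrite CE subrK.
  apply: contraNneq D0 => C0; move: DS.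
  by rewrite -CE C0 expr0n /= (residue_nat 0) => /esym/eqP; rewrite sqrf_eq0.
have eq0 : residue X * residue X + residue a * (residue Y * residue Y) = 0.
  by have := congr1 residue eqD; rewrite DD' !resE.
(* Otherwise the residue of [X / Y] would be a square root of [- a]. *)
have Y0 : residue Y = 0.
  apply/eqP; apply: contraTT (a_nonres (residue X / residue Y)) => Yn0.
  move/eqP: eq0; rewrite negbK expr_div_n -!expr2 addr_eq0 => /eqP ->.
  by rewrite mulNr mulfK // expf_neq0.
have X0 : residue X = 0.
  by move/eqP: eq0; rewrite Y0 mulr0 mulr0 addr0 mulf_eq0 orbb => /eqP.
have [X' XX'] := residue_eq0 X0; have [Y' YY'] := residue_eq0 Y0.
(* Every other term is now divisible by [p ^ 2]; cancelling one [p] leaves [S ^+ 2] divisible by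
   [p]. *)
have S0 : residue S = 0.
  have : p%:R * (p%:R * (X' ^+ 2 + a * Y' ^+ 2 - D' ^+ 2) + S ^+ 2) = 0.
    rewrite -[RHS](subrr (D ^+ 2)) -{1}eqD XX' YY' DD'; ring.
  move/eqP; rewrite mulf_eq0 (negPf padic_p_neq0) /= => /eqP /(congr1 residue).
  rewrite !resE add0r (residue_nat 0) => /eqP.
  by rewrite mulf_eq0 orbb => /eqP.
have [S' SS'] := residue_eq0 S0.
have [||C C0 CE] := IHn X' Y' S' D'.
(* Dividing [D] by [p] lowers its valuation by one, so index [n] detects [D']. *)
- apply: contraNneq Dn => D'n.
  rewrite DD' padic_resM padic_res_nat modnMml -/(dvdn _ _) expnS.
  by rewrite dvdn_mul // /dvdn -padic_resP D'n.
- have pp0 : (p%:R : Zp) ^+ 2 != 0 by rewrite expf_neq0 // padic_p_neq0.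
  apply: (mulfI pp0); move: eqD; rewrite XX' YY' SS' DD' !exprMn => <-; ring.
exists (p%:R * C); first by rewrite mulf_neq0 // padic_p_neq0.
by rewrite SS' DD' !exprMn -CE; ring.
Qed.

Lemma padic_neq0_res x : x != 0 -> exists n, x n != 0%N.
Proof.
move=> x0; apply: contrapT => nex; case/eqP: x0; apply: padic_int_ext => n.
rewrite padic_res0; apply/eqP/negPn/negP => xn; apply: nex; by exists n.
Qed.

End PadicResidue.

(** * Square roots of -1 in the prime field *)

Lemma Fp_sqr_neqN1 (p : nat) : prime p -> (p %% 4 = 3)%N ->
  forall t : 'F_p, t ^+ 2 != -1.
Proof.
move=> p_pr p4 t; apply/eqP => tN1.
have p_odd : odd p by rewrite (divn_eq p 4) p4 oddD oddM andbF.
have t0 : t != 0.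
  apply: contra_eq_neq tN1 => ->.
  by rewrite expr0n /= eq_sym oppr_eq0 oner_neq0.
have := expf_card t; rewrite card_Fp // => tp.
have tp1 : t ^+ p.-1 = 1.
  by apply: (mulfI t0); rewrite mulr1 -exprS prednK ?prime_gt0.
(* Half of [p.-1] is odd, so Fermat's theorem would give [1 = -1]. *)
have pE : p.-1 = (2 * (p %/ 4).*2.+1)%N.
  by rewrite {1}(divn_eq p 4) p4 -mul2n; lia.
move: tp1; rewrite pE exprM tN1 -signr_odd /= odd_double /= expr1 => /eqP.
rewrite eq_sym -subr_eq0 opprK => two0.
by have := Fp_natr2_neq0 p_pr p_odd; rewrite two0.
Qed.

(** For some nonzero [t], the power [t ^+ k] with [k = (p - 1) / 2] differs from 1; its square is 1,
    so it is -1, and [k] is even. *)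
Lemma Fp_sqrN1 (p : nat) : prime p -> (p %% 4 = 1)%N ->
  exists t : 'F_p, t ^+ 2 = -1.
Proof.
move=> p_pr p4.
have p1 := prime_gt1 p_pr.
pose k := (p %/ 4).*2.
have pE : p.-1 = (k * 2)%N by rewrite {1}(divn_eq p 4) p4 /k -mul2n; lia.
have k_gt0 : (0 < k)%N by lia.
(* The polynomial ['X^k - 1] has at most [k] roots, fewer than the [2 k] nonzero elements. *)
have [t t0 tk] : exists2 t : 'F_p, t != 0 & t ^+ k != 1.
  apply: contrapT => all1.
  have /max_poly_roots : ('X^k - 1 : {poly 'F_p}) != 0.
    by rewrite -size_poly_gt0 size_XnsubC.
  move=> /(_ (enum (predC1 0))) /=.
  rewrite enum_uniq -cardE cardC1 card_Fp // size_XnsubC //.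
  have -> : all (root ('X^k - 1)) (enum (predC1 (0 : 'F_p))).
    apply/allP => t; rewrite mem_enum inE => t0.
    rewrite rootE !hornerE subr_eq0; apply: contrapT => /negP tk.
    by apply: all1; exists t.
  by move=> /(_ isT isT); lia.
have := expf_card t; rewrite card_Fp // => tp.
have tp1 : t ^+ p.-1 = 1.
  by apply: (mulfI t0); rewrite mulr1 -exprS prednK ?prime_gt0.
exists (t ^+ (p %/ 4)); rewrite -exprM muln2 -/k.
by move/eqP: tp1; rewrite pE exprM sqrf_eq1 (negPf tk) => /eqP.
Qed.

(* The unit [- v], as a p-adic integer. *)
Definition neg_v (p : nat) (p_pr : prime p) (u : padic_int p_pr) :
  padic_int p_pr := if (p == 1 %[mod 4])%N then u else 1.

(** * Fractions and common denominators *)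

Lemma fraction_tofracE (R : idomainType) (x : {fraction R}) :
  exists n d : R, d != 0 /\ x = tofrac n / tofrac d.
Proof.
elim/quotW: x => r; exists \n_r, \d_r; split; first exact: denom_ratioP.
have d0 : tofrac \d_r != 0 by rewrite tofrac_eq0 denom_ratioP.
apply: (mulIf d0); rewrite divfK //; unlock tofrac.
rewrite -[LHS]FracField.pi_mul; apply/eqmodP.
rewrite /= FracField.equivfE /FracField.mulf !numden_Ratio;
  rewrite ?(oner_eq0, mulr1, mulf_neq0, denom_ratioP) //.
by rewrite mulrC.
Qed.

Section Denominators.
Variable K : fieldType.
Implicit Types a b c d e x y z : K.

Lemma clear_denominators a b c d e x y z : x != 0 -> y != 0 -> z != 0 ->
  (c / x) ^+ 2 + a * (d / y) ^+ 2 + b * (e / z) ^+ 2 = 1 ->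
  (c * y * z) ^+ 2 + a * (d * x * z) ^+ 2 + b * (e * x * y) ^+ 2 =
  (x * y * z) ^+ 2.
Proof.
move=> x0 y0 z0 E; rewrite -[RHS]mul1r -E; field.
by rewrite x0 y0 z0.
Qed.

Lemma divide_denominators b c e x y z : x != 0 -> y != 0 -> z != 0 ->
  c ^+ 2 + b * (e * x * y) ^+ 2 = (x * y * z) ^+ 2 ->
  (c / (x * y * z)) ^+ 2 + b * (e / z) ^+ 2 = 1.
Proof.
move=> x0 y0 z0 E.
have D0 : (x * y * z) ^+ 2 != 0 by rewrite expf_neq0 // !mulf_neq0.
apply: (mulIf D0); rewrite mul1r -[RHS]E; field.
by rewrite x0 y0 z0.
Qed.

End Denominators.

(** * Anisotropy for the given [v], and the square root of [1 - p s^2] in the p-adic field *)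

Section Padic.
Variables (p : nat) (p_pr : prime p) (u : padic_int p_pr).

Lemma tofrac_neg_v : - v_of u = padic_of_int (neg_v u).
Proof.
by rewrite /v_of /neg_v; case: ifP => _; rewrite opprK // /padic_of_int tofrac1.
Qed.

(** If [p] is 3 modulo 4, -1 is not a square modulo [p]. If [p] is 1 modulo 4, it is, so a square
    root of [- u] modulo [p] would give one of [u], which Hensel's lemma would lift. *)
Lemma residue_neg_v_nonres (p_odd : odd p) (u_unit : u \is a GRing.unit)
    (u_nonsquare : ~ exists x : padic p_pr, x ^+ 2 = padic_of_int u) :
  forall t : 'F_p, t ^+ 2 != - residue (neg_v u).
Proof.
rewrite /neg_v => t; case: ifP => /eqP p4; last first.
  rewrite (residue_nat _ 1); apply: Fp_sqr_neqN1 => //.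
  by move: p4; rewrite (modn_small (_ : 1 < 4)%N) //; move: p_odd; lia.
apply/eqP => tu; have [i i2] := Fp_sqrN1 p_pr p4.
have res_u0 : residue u != 0.
  apply/eqP => u0; have := residueM u^-1 u.
  by rewrite mulVr // u0 mulr0 (residue_nat _ 1) => /eqP; rewrite oner_eq0.
have ut : residue u = (i * t) ^+ 2 by rewrite exprMn i2 tu mulN1r opprK.
have it0 : i * t != 0 by rewrite -sqrf_eq0 -ut.
have [r ru] := padic_hensel_sqr p_odd it0 ut.
by case: u_nonsquare; exists (padic_of_int r); rewrite -ru /padic_of_int tofracXn.
Qed.

Lemma tofrac_p : padic_of_int (p%:R : padic_int p_pr) = p%:R.
Proof. exact: rmorph_nat. Qed.

(** Multiplying by a common denominator [D] turns the equation into the homogeneous integral one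
    handled by [padic_descent]; its solution is then divided by [D]. *)
Lemma padic_sqrt (p_odd : odd p) (u_unit : u \is a GRing.unit)
    (u_nonsquare : ~ exists x : padic p_pr, x ^+ 2 = padic_of_int u)
    (x y s : padic p_pr) :
  x ^+ 2 - v_of u * y ^+ 2 + p%:R * s ^+ 2 = 1 ->
  exists2 c : padic p_pr, c != 0 & c ^+ 2 + p%:R * s ^+ 2 = 1.
Proof.
rewrite -mulNr tofrac_neg_v.
have [x1 [x2 [x20 ->]]] := fraction_tofracE x.
have [y1 [y2 [y20 ->]]] := fraction_tofracE y.
have [s1 [s2 [s20 ->]]] := fraction_tofracE s.
pose D := x2 * y2 * s2.
have D0 : D != 0 by rewrite !mulf_neq0.
have [n Dn] := padic_neq0_res D0.
have frac0 (z : padic_int p_pr) : z != 0 -> padic_of_int z != 0.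
  by rewrite /padic_of_int tofrac_eq0.
move=> E.
have /(padic_descent p_odd (residue_neg_v_nonres p_odd u_unit u_nonsquare) Dn)
    [C C0 CE] : (x1 * y2 * s2) ^+ 2 + neg_v u * (y1 * x2 * s2) ^+ 2
     + p%:R * (s1 * x2 * y2) ^+ 2 = D ^+ 2.
  apply/eqP; rewrite -tofrac_eq; apply/eqP.
  rewrite /D !(tofracD, tofracM, tofracXn) -!/(padic_of_int _) tofrac_p.
  by apply: clear_denominators E; apply: frac0.
exists (padic_of_int C / padic_of_int D).
  by rewrite mulf_neq0 ?invr_eq0 ?frac0.
move/(congr1 (@padic_of_int p p_pr)) : CE.
rewrite /D /padic_of_int !(tofracD, tofracM, tofracXn) -!/(padic_of_int _).
by rewrite tofrac_p; apply: divide_denominators; apply: frac0.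
Qed.
End Padic.

(** * Explicit 3 by 3 matrices *)

Section Mx3.
Variable K : fieldType.
Implicit Types a b c d e f g h i : K.

(** The body has the shape of that of [Ry], so that [Ry (Some t)] is an [mx3] by conversion. *)
Definition mx3 a b c d e f g h i : 'M[K]_3 :=
  \matrix_(j < 3, k < 3)
    nth 0 (nth [::] [:: [:: a; b; c]; [:: d; e; f]; [:: g; h; i]] j) k.

Lemma mx3_eta (L : 'M[K]_3) :
  L = mx3 (L 0 0) (L 0 1) (L 0 2) (L 1 0) (L 1 1) (L 1 2)
          (L 2 0) (L 2 1) (L 2 2).
Proof.
apply/matrixP => -[[|[|[|j]]] // Hj] [[|[|[|k]]] // Hk]; rewrite mxE /=;
  congr (L _ _); exact: val_inj.
Qed.

Lemma mx3_inj a b c d e f g h i a' b' c' d' e' f' g' h' i' :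
  mx3 a b c d e f g h i = mx3 a' b' c' d' e' f' g' h' i' ->
  [/\ [/\ a = a', b = b' & c = c'], [/\ d = d', e = e' & f = f']
    & [/\ g = g', h = h' & i = i']].
Proof.
move=> /matrixP E; split; split.
- by have := E 0 0; rewrite !mxE.
- by have := E 0 1; rewrite !mxE.
- by have := E 0 2; rewrite !mxE.
- by have := E 1 0; rewrite !mxE.
- by have := E 1 1; rewrite !mxE.
- by have := E 1 2; rewrite !mxE.
- by have := E 2 0; rewrite !mxE.
- by have := E 2 1; rewrite !mxE.
- by have := E 2 2; rewrite !mxE.
Qed.

Lemma mul_mx3 a b c d e f g h i a' b' c' d' e' f' g' h' i' :
  mx3 a b c d e f g h i *m mx3 a' b' c' d' e' f' g' h' i' =
  mx3 (a * a' + b * d' + c * g') (a * b' + b * e' + c * h')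
      (a * c' + b * f' + c * i')
      (d * a' + e * d' + f * g') (d * b' + e * e' + f * h')
      (d * c' + e * f' + f * i')
      (g * a' + h * d' + i * g') (g * b' + h * e' + i * h')
      (g * c' + h * f' + i * i').
Proof.
apply/matrixP => -[[|[|[|j]]] // Hj] [[|[|[|k]]] // Hk];
  by rewrite !mxE !big_ord_recl big_ord0 !mxE /= addr0 addrA.
Qed.

Lemma tr_mx3 a b c d e f g h i :
  (mx3 a b c d e f g h i)^T = mx3 a d g b e h c f i.
Proof.
by apply/matrixP => -[[|[|[|j]]] // Hj] [[|[|[|k]]] // Hk]; rewrite !mxE.
Qed.

Lemma det_mx3 a b c d e f g h i :
  \det (mx3 a b c d e f g h i) =
  a * (e * i - f * h) - b * (d * i - f * g) + c * (d * h - e * g).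
Proof.
rewrite (expand_det_row _ 0) !big_ord_recl big_ord0 /cofactor.
rewrite !(expand_det_row _ 0) !big_ord_recl !big_ord0 /cofactor.
rewrite !(expand_det_row _ 0) !big_ord_recl !big_ord0 /cofactor !det_mx00.
rewrite !mxE /=; ring.
Qed.

Lemma diag3_mx3 a b c : diag3 a b c = mx3 a 0 0 0 b 0 0 0 c.
Proof.
by apply/matrixP => -[[|[|[|j]]] // Hj] [[|[|[|k]]] // Hk]; rewrite !mxE.
Qed.

Lemma mx3_1 : 1%:M = mx3 1 0 0 0 1 0 0 0 1.
Proof.
by apply/matrixP => -[[|[|[|j]]] // Hj] [[|[|[|k]]] // Hk]; rewrite !mxE.
Qed.

(** Cancelling [L] would leave [1 = -1]. This separates the two decompositions by their first
    factors. *)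
Lemma diag3_mulmx_neq (L : 'M[K]_3) :
  2%:R != 0 :> K -> L \in unitmx -> L <> diag3 1 (-1) (-1) *m L.
Proof.
move=> two0 uL /(congr1 (mulmx^~ (invmx L))).
rewrite mulmxK // mulmxV // mx3_1 diag3_mx3 => /mx3_inj[_ [_ /eqP + _] _].
by rewrite -addr_eq0 -mulr2n (negPf two0).
Qed.

Lemma mul_mx3_delta (L : 'M[K]_3) (i : 'I_3) :
  L *m delta_mx i 0 = delta_mx i 0 :> 'cV_3 <-> forall j, L j i = (j == i)%:R.
Proof.
rewrite -colE; split=> [/matrixP E j|E].
  by have := E j 0; rewrite !mxE andbT.
by apply/matrixP => j k; rewrite !mxE E ord1 andbT.
Qed.

End Mx3.

(** * Isometries of [diag3 1 a b] over an arbitrary field *)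

Section Rotations.
Variables (K : fieldType) (a b : K).
Hypotheses (a0 : a != 0) (b0 : b != 0).
Implicit Types (L M A B C : 'M[K]_3) (c s t : K).

(** With [a = - v] and [b = p] this is [SO3] by conversion; only the existence of the square root
    [c] depends on p-adic arithmetic. *)
Definition isom : {pred 'M[K]_3} :=
  [pred L | (L^T *m diag3 1 a b *m L == diag3 1 a b) && (\det L == 1)].

Definition isom_fix (i : 'I_3) : {pred 'M[K]_3} :=
  [pred L | (L \in isom) && (L *m delta_mx i 0 == delta_mx i 0 :> 'cV_3)].

(** Scaling the sine by [a] and [b] keeps the entries free of division; the norm equation is
    [c ^+ 2 + a * b * t ^+ 2 = 1]. *)
Definition rotx c t := mx3 1 0 0  0 c (- (b * t))  0 (a * t) c.
Definition roty c s := mx3 c 0 (- (b * s))  0 1 0  s 0 c.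

Lemma isom_unit L : L \in isom -> L \in unitmx.
Proof. by case/andP => _ /eqP dL; rewrite unitmxE dL unitr1. Qed.

Lemma isomM L M : L \in isom -> M \in isom -> L *m M \in isom.
Proof.
case/andP => /eqP fL /eqP dL /andP[/eqP fM /eqP dM]; apply/andP; split.
  rewrite trmx_mul !mulmxA; apply/eqP.
  by rewrite -[RHS]fM -[in RHS]fL !mulmxA.
by rewrite det_mulmx dL dM mulr1.
Qed.

Lemma isomV L : L \in isom -> invmx L \in isom.
Proof.
move=> Lisom; have uL := isom_unit Lisom.
case/andP: Lisom => /eqP fL /eqP dL; apply/andP; split.
  rewrite -{1}fL !mulmxA -trmx_mul mulmxV // trmx1 mul1mx.
  by rewrite -mulmxA mulmxV // mulmx1.
by rewrite det_inv dL invr1.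
Qed.

Lemma isom_fixP i L :
  reflect (L \in isom /\ forall j, L j i = (j == i)%:R) (L \in isom_fix i).
Proof.
apply: (iffP andP) => -[Lisom fL]; split=> //.
  by apply/mul_mx3_delta/eqP.
by apply/eqP/mul_mx3_delta.
Qed.

Lemma isom_fixM i L M :
  L \in isom_fix i -> M \in isom_fix i -> L *m M \in isom_fix i.
Proof.
case/andP => Li /eqP Lf /andP[Mi /eqP Mf]; apply/andP; split.
  exact: isomM.
by rewrite -mulmxA Mf Lf.
Qed.

Lemma isom_mx3 d11 d12 d13 d21 d22 d23 d31 d32 d33 :
  mx3 d11 d12 d13 d21 d22 d23 d31 d32 d33 \in isom ->
  [/\ [/\ d11 ^+ 2 + a * d21 ^+ 2 + b * d31 ^+ 2 = 1,
          d12 ^+ 2 + a * d22 ^+ 2 + b * d32 ^+ 2 = a &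
          d13 ^+ 2 + a * d23 ^+ 2 + b * d33 ^+ 2 = b],
      [/\ d11 * d12 + a * d21 * d22 + b * d31 * d32 = 0,
          d11 * d13 + a * d21 * d23 + b * d31 * d33 = 0 &
          d12 * d13 + a * d22 * d23 + b * d32 * d33 = 0] &
      d11 * (d22 * d33 - d23 * d32) - d12 * (d21 * d33 - d23 * d31)
      + d13 * (d21 * d32 - d22 * d31) = 1].
Proof.
case/andP => /eqP; rewrite tr_mx3 diag3_mx3 !mul_mx3 det_mx3 => /mx3_inj.
case=> -[e11 e12 e13] [_ e22 e23] [_ _ e33] /eqP dL.
split=> //; split; [rewrite -[RHS]e11|rewrite -[RHS]e22|rewrite -[RHS]e33|
  rewrite -[RHS]e12|rewrite -[RHS]e13|rewrite -[RHS]e23]; ring.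
Qed.

(** Orthogonality to the first column and the determinant are two linear equations in the second
    column [(d, f)]. Their determinant is the norm [x] of the first column, and Cramer's rule gives
    the solution. *)
Lemma isom2 x y c d e f : x != 0 -> y != 0 -> c * f - d * e = 1 ->
  x * c ^+ 2 + y * e ^+ 2 = x -> x * c * d + y * e * f = 0 ->
  f = c /\ x * d = - (y * e).
Proof.
move=> x0 y0 det1 n1 n12.
have xf : x * f = x * c.
  have -> : x * f = (x * c ^+ 2 + y * e ^+ 2) * f by rewrite n1.
  have -> : x * c = x * c * (c * f - d * e) + e * (x * c * d + y * e * f).
    by rewrite det1 n12; ring.
  ring.
have fc : f = c by apply: (mulfI x0).
split=> //.
have -> : x * d = (x * c ^+ 2 + y * e ^+ 2) * d by rewrite n1.
have -> : - (y * e) = c * (x * c * d + y * e * f) - y * e * (c * f - d * e).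
  by rewrite det1 n12; ring.
by rewrite fc; ring.
Qed.

(** Orthogonality to the fixed first column clears the first row; [isom2] describes the remaining
    block. *)
Lemma rotxP L : reflect
  (exists c t, c ^+ 2 + a * b * t ^+ 2 = 1 /\ L = rotx c t) (L \in isom_fix 0).
Proof.
apply: (iffP (isom_fixP _ _)) => [[]|[c [t [n ->]]]]; last first.
  split; last by case=> [[|[|[|j]]] // Hj]; rewrite mxE.
  apply/andP; rewrite /rotx tr_mx3 diag3_mx3 !mul_mx3 det_mx3.
  split; last by apply/eqP; rewrite -[RHS]n; ring.
  (* The entries that are not polynomial identities are [a] or [b] times the norm [n]. *)
  apply/eqP; congr (mx3 _ _ _ _ _ _ _ _ _);
    first [ring | rewrite -[RHS]mulr1 -[X in _ = _ * X]n; ring].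
rewrite {1}(mx3_eta L) => /isom_mx3 [[_ n2 _] [n12 n13 n23] det1] fL.
move: n2 n12 n13 n23 det1; rewrite !fL /=.
rewrite !(mulr0, mul0r, mul1r, addr0, subr0) => n2 n12 n13 n23 det1.
rewrite n12 n13 in n2 n23 det1.
rewrite !(expr0n, mulr0, mul0r, add0r, addr0, subr0) /= in n2 n23 det1.
have [L22 L12] := isom2 a0 b0 det1 n2 n23.
exists (L 1 1), (L 2 1 / a); split.
  apply: (mulfI a0); rewrite mulr1 -[RHS]n2; field.
  by rewrite a0.
rewrite {1}(mx3_eta L) !fL n12 n13 L22 /rotx; congr (mx3 _ _ _ _ _ _ _ _ _).
  by apply: (mulfI a0); rewrite L12; field; rewrite a0.
by field; rewrite a0.
Qed.

Lemma rotyP L : reflect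
  (exists c s, c ^+ 2 + b * s ^+ 2 = 1 /\ L = roty c s) (L \in isom_fix 1).
Proof.
apply: (iffP (isom_fixP _ _)) => [[]|[c [t [n ->]]]]; last first.
  split; last by case=> [[|[|[|j]]] // Hj]; rewrite mxE.
  apply/andP; rewrite /roty tr_mx3 diag3_mx3 !mul_mx3 det_mx3.
  split; last by apply/eqP; rewrite -[RHS]n; ring.
  apply/eqP; congr (mx3 _ _ _ _ _ _ _ _ _);
    first [ring | rewrite -[RHS]mulr1 -[X in _ = _ * X]n; ring].
rewrite {1}(mx3_eta L) => /isom_mx3 [[n1 _ _] [n12 n13 n23] det1] fL.
move: n1 n12 n13 n23 det1; rewrite !fL /=.
rewrite !(mulr0, mul0r, mulr1, add0r, addr0, subr0) => n1 n12 n13 n23 det1.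
have L10 : L 1 0 = 0 by apply: (mulfI a0); rewrite mulr0.
have L12 : L 1 2 = 0 by apply: (mulfI a0); rewrite mulr0.
rewrite L10 L12 in n1 n13 det1.
rewrite !(expr0n, mulr0, mul0r, mul1r, add0r, addr0, subr0, sub0r) /=
  in n1 n13 det1.
have [|||L22 L02] := @isom2 1 b (L 0 0) (L 0 2) (L 2 0) (L 2 2) (oner_neq0 _) b0.
- by rewrite -[RHS]det1; ring.
- by rewrite -[RHS]n1; ring.
- by rewrite -[RHS]n13; ring.
exists (L 0 0), (L 2 0); split=> //.
rewrite {1}(mx3_eta L) !fL L10 L12 L22 /roty; congr (mx3 _ _ _ _ _ _ _ _ _).
by rewrite -L02 mul1r.
Qed.

(** * Factorizations of one isometry [M], given a square root [c] *)

Section Euler.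
Variables (M : 'M[K]_3) (c : K).
Hypotheses (M_isom : M \in isom) (c0 : c != 0).
Let s := - (M 0 2 / b).
Hypothesis n : c ^+ 2 + b * s ^+ 2 = 1.
(** The third column of [rotx al t *m roty c s] is [(- b s, - b t c, al c)]; equating it with that
    of [M] gives [s] and these two parameters. *)
Let A := rotx (M 2 2 / c) (- (M 1 2 / (b * c))).
Let B := roty c s.
Let C := invmx (A *m B) *m M.

Lemma euler_Ax : A \in isom_fix 0.
Proof.
apply/rotxP; exists (M 2 2 / c), (- (M 1 2 / (b * c))); split=> //.
move: M_isom; rewrite {1}(mx3_eta M) => /isom_mx3 [[_ _ n3] _ _].
have bs : b * s = - M 0 2 by rewrite /s; field.
(* The norm of the third column of [M], less the part [(b s)^2] carried by its first entry. *)
have bc : b * c ^+ 2 = a * M 1 2 ^+ 2 + b * M 2 2 ^+ 2.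
  have -> : b * c ^+ 2 = b * (c ^+ 2 + b * s ^+ 2) - (b * s) ^+ 2 by ring.
  by rewrite n mulr1 bs -{1}n3; ring.
have bc0 : b * c ^+ 2 != 0 by rewrite mulf_neq0 // expf_neq0.
apply: (mulfI bc0); rewrite mulr1 [RHS]bc; field.
by rewrite c0 b0.
Qed.

Lemma euler_By : B \in isom_fix 1.
Proof. by apply/rotyP; exists c, s. Qed.

Lemma euler_AB : A *m B \in isom.
Proof. by apply: isomM; [case/isom_fixP: euler_Ax|case/isom_fixP: euler_By]. Qed.

Lemma euler_M : M = A *m B *m C.
Proof. by rewrite /C mulKVmx // isom_unit // euler_AB. Qed.

Lemma euler_col3 : A *m B *m delta_mx 2 0 = M *m delta_mx 2 0 :> 'cV_3.
Proof.
rewrite /A /B /rotx /roty mul_mx3 -!colE; apply/matrixP => i j.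
rewrite !mxE; case: i => [[|[|[|i]]] // Hi] /=.
- have -> : Ordinal Hi = 0 by exact: val_inj.
  by rewrite /s; field.
- have -> : Ordinal Hi = 1 by exact: val_inj.
  by field; rewrite c0 b0.
have -> : Ordinal Hi = 2 by exact: val_inj.
by field; rewrite c0 b0.
Qed.

(** [A *m B] and [M] send the third basis vector to the same image, so their quotient fixes it. *)
Lemma euler_Cz : C \in isom_fix 2.
Proof.
apply/andP; split; first by rewrite isomM // isomV // euler_AB.
by rewrite /C -mulmxA -euler_col3 mulKmx // isom_unit // euler_AB.
Qed.

Lemma diag3_rotx : diag3 1 (-1) (-1) \in isom_fix 0.
Proof.
apply/rotxP; exists (-1), 0; split; first by ring.
by rewrite diag3_mx3 /rotx; congr (mx3 _ _ _ _ _ _ _ _ _); ring.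
Qed.

Lemma diag3_rotz : diag3 (-1) (-1) 1 \in isom_fix 2.
Proof.
apply/isom_fixP; split; last by case=> [[|[|[|j]]] // Hj]; rewrite !mxE.
apply/andP; rewrite !diag3_mx3 tr_mx3 !mul_mx3 det_mx3.
split; last by apply/eqP; ring.
by apply/eqP; congr (mx3 _ _ _ _ _ _ _ _ _); ring.
Qed.

(** The half-turn about the first axis commutes with [A], and the two half-turns around
    [roty (- c) s] turn it into [roty c s]. *)
Lemma roty_flip :
  diag3 1 (-1) (-1) *m A *m roty (- c) s *m diag3 (-1) (-1) 1 = A *m B.
Proof.
rewrite !diag3_mx3 /A /B /rotx /roty !mul_mx3.
by congr (mx3 _ _ _ _ _ _ _ _ _); ring.
Qed.

Lemma euler_uniq A' B' C' :
  [/\ A' \in isom_fix 0, B' \in isom_fix 1, C' \in isom_fix 2 &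
      M = A' *m B' *m C'] <->
  (A', B', C') = (A, B, C) \/
  (A', B', C') = (diag3 1 (-1) (-1) *m A, roty (- c) s,
                  diag3 (-1) (-1) 1 *m C).
Proof.
have MAB2 : M = diag3 1 (-1) (-1) *m A *m roty (- c) s
                *m (diag3 (-1) (-1) 1 *m C).
  by rewrite mulmxA roty_flip -euler_M.
split; last first.
  case=> -[-> -> ->]; split.
  - exact: euler_Ax.
  - exact: euler_By.
  - exact: euler_Cz.
  - exact: euler_M.
  - by rewrite isom_fixM // ?diag3_rotx // euler_Ax.
  - by apply/rotyP; exists (- c), s; rewrite sqrrN.
  - by rewrite isom_fixM // ?diag3_rotz // euler_Cz.
  - exact: MAB2.
case=> Ax By Cz ME.
have ABu : A' *m B' \in unitmx.
  by apply: isom_unit; apply: isomM; [case/isom_fixP: Ax|case/isom_fixP: By].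
have /rotxP [al [t [nx A'E]]] := Ax.
have /rotyP [c' [s' [ny B'E]]] := By.
(* [C'] fixes the third basis vector, so [A' *m B'] has the third column of [M]. *)
have col3 : M *m delta_mx 2 0 = A' *m B' *m delta_mx 2 0 :> 'cV_3.
  by rewrite ME -!mulmxA; case/andP: Cz => _ /eqP ->.
rewrite A'E B'E /rotx /roty mul_mx3 -!colE in col3; move/matrixP in col3.
have := col3 2 0; have := col3 1 0; have := col3 0 0; rewrite !mxE /= {col3}.
move=> m02 m12 m22.
have ss : s' = s by rewrite /s m02; field.
(* Equal sines and the norm equation leave only the sign of the cosine free. *)
have : c' ^+ 2 == c ^+ 2.
  by rewrite -(inj_eq (addIr (b * s ^+ 2))) n -{1}ss ny.
rewrite eqf_sqr => /orP[/eqP cc|/eqP cc].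
  left; have AA : A' = A.
    rewrite A'E /A /rotx m12 m22 cc.
    by congr (mx3 _ _ _ _ _ _ _ _ _); field; rewrite ?b0 ?c0.
  have BB : B' = B by rewrite B'E /B ss cc.
  have CC : C' = C by rewrite -[LHS](mulKmx ABu) -ME AA BB.
  by rewrite AA BB CC.
right; have AA : A' = diag3 1 (-1) (-1) *m A.
  rewrite A'E /A diag3_mx3 /rotx mul_mx3 m12 m22 cc.
  by congr (mx3 _ _ _ _ _ _ _ _ _); field; rewrite ?b0 ?c0.
have BB : B' = roty (- c) s by rewrite B'E ss cc.
have CC : C' = diag3 (-1) (-1) 1 *m C.
  by rewrite -[LHS](mulKmx ABu) -ME MAB2 -AA -BB mulKmx.
by rewrite AA BB CC.
Qed.

End Euler.

Lemma euler_decomposition M c (s := - (M 0 2 / b)) :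
  2%:R != 0 :> K -> M \in isom -> c != 0 -> c ^+ 2 + b * s ^+ 2 = 1 ->
  exists A C,
    let D1 := (A, roty c s, C) in
    let D2 := (diag3 1 (-1) (-1) *m A, roty (- c) s,
               diag3 (-1) (-1) 1 *m C) in
    [/\ A \in isom_fix 0, C \in isom_fix 2, M = A *m roty c s *m C, D1 <> D2
      & forall A' B' C',
          [/\ A' \in isom_fix 0, B' \in isom_fix 1, C' \in isom_fix 2
             & M = A' *m B' *m C'] <->
          (A', B', C') = D1 \/ (A', B', C') = D2].
Proof.
move=> two0 Mi c0 n; have Ax := euler_Ax Mi c0 n.
eexists; eexists; split.
- exact: Ax.
- exact: (euler_Cz Mi c0 n).
- exact: (euler_M Mi c0 n).
- have uA : rotx (M 2 2 / c) (- (M 1 2 / (b * c))) \in unitmx.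
    by apply: isom_unit; case/isom_fixP: Ax.
  by case=> /(diag3_mulmx_neq two0 uA).
- exact: (euler_uniq Mi c0 n).
Qed.

(** The matrix [Q^-1 M^T Q], with [Q = diag3 1 a b], is a left inverse of [M], hence a right
    inverse; the first diagonal entry of that product is a relation on the first row. It is written
    in the variables used by [padic_sqrt]. *)
Lemma isom_row0 M : M \in isom ->
  M 0 0 ^+ 2 + a * (M 0 1 / a) ^+ 2 + b * (- (M 0 2 / b)) ^+ 2 = 1.
Proof.
case/andP => /eqP fM _.
have inv1 : diag3 1 a^-1 b^-1 *m diag3 1 a b = 1%:M :> 'M[K]_3.
  rewrite !diag3_mx3 mul_mx3 mx3_1.
  by congr (mx3 _ _ _ _ _ _ _ _ _); field; rewrite ?a0 ?b0.
have /mulmx1C : diag3 1 a^-1 b^-1 *m (M^T *m diag3 1 a b) *m M = 1%:M.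
  by rewrite -mulmxA fM inv1.
rewrite {1 2}(mx3_eta M) !diag3_mx3 tr_mx3 !mul_mx3 mx3_1 => /mx3_inj.
case=> -[e _ _] _ _; rewrite -[RHS]e; field.
by rewrite a0 b0.
Qed.

End Rotations.

(** * Rational parametrization of the conic [c^2 + b s^2 = 1] *)

Section Cayley.
Variable K : fieldType.
Implicit Types b c s t : K.

(* The half-angle parameter: [R_y(eta)] has [eta = s / (1 + c)]. *)
Lemma cayley b c s (t := s / (1 + c)) (d := 1 + b * t ^+ 2) :
  2%:R != 0 :> K -> 1 + c != 0 -> c ^+ 2 + b * s ^+ 2 = 1 ->
  [/\ d != 0, 1 - b * t ^+ 2 = c * d & 2%:R * t = s * d].
Proof.
move=> two0 c1 n.
(* On the conic, [(1 + c)^2 + b s^2 = 2 (1 + c)]. *)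
have dE : d * (1 + c) = 2%:R.
  have -> : d * (1 + c)
            = ((1 + c) ^+ 2 + (c ^+ 2 + b * s ^+ 2) - c ^+ 2) / (1 + c).
    by rewrite /d /t; field.
  by rewrite n; field.
split.
- by apply: contra_neq two0 => d0; rewrite -dE d0 mul0r.
- have -> : 1 - b * t ^+ 2 = 2%:R - d by rewrite /d; ring.
  by rewrite -dE; ring.
- by rewrite -dE /t; field.
Qed.

(** Since [b t'^2] is the inverse of [b t^2], the cosine changes sign and the sine is kept. *)
Lemma cayley_inv b c s t (d := 1 + b * t ^+ 2)
    (t' := (b * t)^-1) (d' := 1 + b * t' ^+ 2) :
  b != 0 -> t != 0 -> d != 0 ->
  1 - b * t ^+ 2 = c * d -> 2%:R * t = s * d ->
  [/\ d' != 0, 1 - b * t' ^+ 2 = - c * d' & 2%:R * t' = s * d'].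
Proof.
move=> b0 t0 d0 ec es.
have dV : d' = d / (b * t ^+ 2) by rewrite /d' /d /t'; field; rewrite t0 b0.
rewrite dV !mulrA mulNr -ec -es /t'; split.
- by rewrite !(mulf_neq0, invr_eq0, expf_neq0).
- by field; rewrite t0 b0.
- by field; rewrite t0 b0.
Qed.

End Cayley.

(** * The matrices [Ry] as rotations, and inversion of their parameter *)

Section RyRotation.
Variables (p : nat) (p_pr : prime p).
Local Notation Qp := (padic p_pr).
Implicit Types c s t : Qp.

Lemma Ry_roty t c s : 1 + p%:R * t ^+ 2 != 0 ->
  1 - p%:R * t ^+ 2 = c * (1 + p%:R * t ^+ 2) ->
  2%:R * t = s * (1 + p%:R * t ^+ 2) ->
  Ry (Some t) = roty p%:R c s.
Proof.
move=> d0 ec es; pose d := 1 + p%:R * t ^+ 2.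
rewrite -[LHS]/(mx3 ((1 - p%:R * t ^+ 2) / d) 0 (- (2%:R * p%:R * t / d))
                    0 1 0 (2%:R * t / d) 0 ((1 - p%:R * t ^+ 2) / d)).
by rewrite ec (mulrAC 2%:R) es (mulrAC _ _ p%:R) !mulfK // (mulrC s).
Qed.

Lemma Ry_param c s : 2%:R != 0 :> Qp -> p%:R != 0 :> Qp ->
  c ^+ 2 + p%:R * s ^+ 2 = 1 ->
  exists eta : option Qp,
    Ry eta = roty p%:R c s /\ Ry (inv_pmul eta) = roty p%:R (- c) s.
Proof.
move=> two0 p0 n.
have RyNone : Ry (None : option Qp) = roty p%:R (-1) 0.
  by rewrite /Ry diag3_mx3 /roty mulr0 oppr0.
have Ry0 : Ry (Some (0 : Qp)) = roty p%:R 1 0.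
  have d0 : 1 + p%:R * (0 : Qp) ^+ 2 = 1 by ring.
  by apply: Ry_roty; rewrite d0 ?oner_eq0 //; ring.
(* The point [c = -1] forces [s = 0] and is the parameter at infinity; its partner is [c = 1], at
   parameter 0. *)
have [c1 | c1] := eqVneq (1 + c) 0.
  have cE : c = -1 by apply/eqP; rewrite -addr_eq0 addrC c1.
  have s0 : s = 0.
    apply/eqP; rewrite -sqrf_eq0 -(mulrI_eq0 _ (mulfI p0)).
    by apply/eqP; move/eqP: n; rewrite cE sqrrN expr1n -subr_eq0 addrAC subrr
      add0r => /eqP.
  by exists None; rewrite cE s0 opprK.
have [s0 | s0] := eqVneq s 0.
  have cE : c = 1.
    move/eqP: n; rewrite s0 expr0n /= mulr0 addr0 sqrf_eq1 => /orP[/eqP //|].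
    by rewrite -addr_eq0 addrC (negPf c1).
  by exists (Some 0); rewrite cE s0 /inv_pmul eqxx.
pose t := s / (1 + c).
have t0 : t != 0 by apply: mulf_neq0; rewrite ?invr_eq0.
have [d0 ec es] := cayley two0 c1 n.
have [d'0 ec' es'] := cayley_inv p0 t0 d0 ec es.
by exists (Some t); rewrite /inv_pmul (negPf t0); split; exact: Ry_roty.
Qed.

End RyRotation.

Theorem theorem11 (p : nat) (p_pr : prime p) (p_odd : odd p)
    (u : padic_int p_pr) (u_unit : u \is a GRing.unit)
    (u_nonsquare : ~ exists x : padic p_pr, x ^+ 2 = padic_of_int u)
    (M : 'M[padic p_pr]_3) (M_SO3 : M \in SO3 u) :
  exists (A : 'M[padic p_pr]_3) (eta : option (padic p_pr))
         (C : 'M[padic p_pr]_3),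
    let D1 : 'M[padic p_pr]_3 * 'M[padic p_pr]_3 * 'M[padic p_pr]_3 :=
      (A, Ry eta, C) in
    let D2 : 'M[padic p_pr]_3 * 'M[padic p_pr]_3 * 'M[padic p_pr]_3 :=
      (diag3 1 (-1) (-1) *m A, Ry (inv_pmul eta), diag3 (-1) (-1) 1 *m C) in
    [/\ A \in Gx u, C \in Gz u, M = A *m Ry eta *m C,
        D1 <> D2
      & forall A' B' C' : 'M[padic p_pr]_3,
          [/\ A' \in Gx u, B' \in Gy u, C' \in Gz u & M = A' *m B' *m C'] <->
          (A', B', C') = D1 \/ (A', B', C') = D2].
Proof.
have frac0 (z : padic_int p_pr) : residue z != 0 -> padic_of_int z != 0.
  by rewrite /padic_of_int tofrac_eq0; apply: contra_neq => ->;
    exact: (residue_nat _ 0).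
(* Nonresiduosity tested at [t = 0] says that the residue of [- v] is nonzero. *)
have a0 : - v_of u != 0.
  rewrite tofrac_neg_v; apply: frac0.
  have := residue_neg_v_nonres p_odd u_unit u_nonsquare 0.
  by rewrite expr0n /= eq_sym oppr_eq0.
have b0 : p%:R != 0 :> padic p_pr.
  by rewrite -tofrac_p /padic_of_int tofrac_eq0 padic_p_neq0.
have two0 : 2%:R != 0 :> padic p_pr.
  rewrite -(rmorph_nat (@tofrac (padic_int p_pr))); apply: frac0.
  by rewrite residue_nat Fp_natr2_neq0.
have Mi : M \in isom (- v_of u) p%:R by [].
(* The p-adic input: the first row of [M] provides the point from which descent extracts [c]. *)
have [c c0 n] : exists2 c : padic p_pr, c != 0 &
    c ^+ 2 + p%:R * (- (M 0 2 / p%:R)) ^+ 2 = 1.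
  apply: (padic_sqrt p_odd u_unit u_nonsquare (x := M 0 0)
    (y := M 0 1 / - v_of u)).
  by rewrite -mulNr; exact: isom_row0.
have [eta [etaE etaVE]] := Ry_param two0 b0 n.
have [A [C]] := euler_decomposition a0 b0 two0 Mi c0 n.
by rewrite -etaE -etaVE => dec; exists A, eta, C.
Qed.
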